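(* Let $p$ be a prime, $q$ a power of $p$, $n\ge1$, and write $n=p^em$ with $p\nmid m$. Let $h_{p,n}\in\mathbb F_p[X_1,\dots,X_n]$ be the polynomial defined in the context. Let $f=X^n+a_1X^{n-1}+\cdots+a_n\in\mathbb F_q[X]$ be irreducible. If $h_{p,n}(a_1,\dots,a_n)\ne0$, then $f$ is normal over $\mathbb F_q$, i.e., its roots are linearly independent over $\mathbb F_q$.
   Context: For $l\ge1$ let $\epsilon_l=e^{2\pi\sqrt{-1}/l}$ and $\Psi_l(X_0,\dots,X_{l-1})=\prod_{i\in(\mathbb Z/l\mathbb Z)^\times}\bigl(\sum_{j\in\mathbb Z/l\mathbb Z}\epsilon_l^{ij}X_j\bigr)\in\mathbb Z[X_0,\dots,X_{l-1}]$. Let $S_l$ act on polynomials by $\sigma(X_j)=X_{\sigma(j)}$, let $\mathcal C_l$ be a system of representatives of the left cosets of the stabilizer of $\Psi_l$ in $S_l$, and $\Phi_l=\prod_{\sigma\in\mathcal C_l}\sigma(\Psi_l)$ (symmetric, in $\mathbb Z[X_0,\dots,X_{l-1}]$). For $l\mid n$, let $\mathcal P_{n,l}$ be the set of unordered partitions of $\{0,\dots,n-1\}$ into $l$ parts $P_0,\dots,P_{l-1}$ of size $n/l$, and $\Theta_{n,l}=\prod_{\{P_0,\dots,P_{l-1}\}\in\mathcal P_{n,l}}\Phi_l\bigl(\sum_{a\in P_0}X_a,\dots,\sum_{a\in P_{l-1}}X_a\bigr)$, a symmetric polynomial in $\mathbb Z[X_0,\dots,X_{n-1}]$; let $\theta_{n,l}\in\mathbb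 Z[X_1,\dots,X_n]$ be the unique polynomial with $\Theta_{n,l}=\theta_{n,l}(s_1,\dots,s_n)$, $s_i$ the $i$-th elementary symmetric polynomial in $X_0,\dots,X_{n-1}$. For $l\mid m$, let $\theta_{p,n,l}\in\mathbb F_p[X_1,\dots,X_n]$ be the reduction of $\theta_{n,l}$ modulo $p$, and $h_{p,n}=\prod_{l\mid m}\theta_{p,n,l}$. *)

(* Defs.v *)
From HB Require Import structures.
From mathcomp Require Import all_boot all_order all_algebra all_fingroup all_field.
From mathcomp Require Import mpoly.
From Stdlib Require Import ClassicalEpsilon.
Set Implicit Arguments. Unset Strict Implicit. Unset Printing Implicit Defensive.
Import GRing.Theory Num.Theory.
Local Open Scope ring_scope.

(* eps_l = e^{2 pi i / l} : (l.-root (-1)) is the l-th root of -1 of minimal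
   nonnegative argument, i.e. e^{i pi / l}; its square is e^{2 pi i / l}. *)
Definition eps (l : nat) : algC := (l.-root (-1)) ^+ 2.

Definition Psi (l : nat) : {mpoly algC[l]} :=
  \prod_(i < l | coprime i l) \sum_(j < l) (eps l ^+ (i * j)%N) *: 'X_j.

(* Phi_l = prod over a system of representatives C_l of left cosets of the
   stabilizer Stab of Psi_l in S_l of sigma(Psi_l).  sigma |-> sigma(Psi_l)
   induces a bijection between left cosets sigma*Stab and the orbit of Psi_l,
   so this is the product over the distinct elements of the orbit. *)
Definition Phi (l : nat) : {mpoly algC[l]} :=
  \prod_(P <- undup [seq msym s (Psi l) | s : 'S_l]) P.

Definition part_nl (n l : nat) (P : {set {set 'I_n}}) : bool :=
  partition P [set: 'I_n] && (#|P| == l) && [forall B in P, #|B| == (n %/ l)%N].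
Arguments part_nl : clear implicits.

(* Theta_{n,l}: the blocks are listed in an (arbitrary) order, which is
   irrelevant since Phi_l is symmetric. *)
Definition Theta (n l : nat) : {mpoly algC[n]} :=
  \prod_(P : {set {set 'I_n}} | part_nl n l P)
     (Phi l \mPo [tuple \sum_(a in nth set0 (enum P) j) 'X_a | j < l]).

(* theta_{n,l} in Z[X_1..X_n] with Theta_{n,l} = theta_{n,l}(s_1,..,s_n);
   variable 'X_i (i < n) stands for X_{i+1}.  Defined by (classical) choice
   of the polynomial satisfying the defining property (it exists and is
   unique). *)
Definition theta_spec (n l : nat) (t : {mpoly int[n]}) : Prop :=
  map_mpoly (fun z : int => z%:~R : algC) t
    \mPo [tuple mesym n algC i.+1 | i < n] = Theta n l.
Arguments theta_spec : clear implicits.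

Definition theta (n l : nat) : {mpoly int[n]} :=
  epsilon (inhabits 0) (theta_spec n l).

Definition theta_p (p n l : nat) : {mpoly 'F_p[n]} :=
  map_mpoly (fun z : int => z%:~R : 'F_p) (theta n l).

Definition h_pn (p n : nat) : {mpoly 'F_p[n]} :=
  let m := (n %/ p ^ logn p n)%N in
  \prod_(l < m.+1 | (l %| m)%N) theta_p p n l.

(* Main.v *)
(** If the conjugates [alpha^(q^i)] are dependent over [F_q], then the polynomial
    [A = sum_i alpha^(q^i) X^i] is not coprime to [X^n - 1], so some [zeta] with
    [zeta^n = 1] in the algebraic closure satisfies [A(zeta) = 0].  In
    characteristic [p] the order [l] of [zeta] divides [m].  Grouping the indices
    modulo [l] gives a partition into [l] blocks of size [n / l] at which the
    reduction of [Psi_l] modulo [p] vanishes, hence so do [Theta_{n,l}] at the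
    roots, [theta_{n,l}] at the coefficients, and [h_{p,n}].

    The reduction of [Psi_l] makes sense because [Psi_l] is symmetric in the roots
    of the cyclotomic polynomial: its coefficients are universal integer
    polynomials in the coefficients of ['Phi_l], in every field that contains a
    primitive [l]-th root of unity.  Signs are handled by working with [- alpha],
    whose elementary symmetric functions are exactly the [a_i]. *)

Require Import Defs.
From Stdlib Require Import ClassicalEpsilon.
From HB Require Import structures.
From mathcomp Require Import all_boot all_order all_algebra all_fingroup all_field.
From mathcomp Require Import mpoly.
From mathcomp Require Import ring.
Import Order.TTheory GRing.Theory Num.Theory.
Local Open Scope ring_scope.

(** * The root of unity [eps l] is primitive *)

Lemma norm_unity_root (N : nat) (x : algC) : (0 < N)%N -> x ^+ N = 1 -> `|x| = 1.
Proof.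
move=> N_gt0 xN; apply/eqP; rewrite -(@pexpr_eq1 _ `|x| N) ?normr_ge0 //.
by rewrite -normrX xN normr1.
Qed.

(** The sum of the two conditions gives [0 <= 'Re x]. Their product, divided by [1 - 'Re g], gives
    [2 * 'Re x ^+ 2 >= 1 + 'Re g]: the angle of [x] is at most half that of [g]. If
    ['Re x <= 'Re g], the left side would be at most [2 * 'Re g < 1 + 'Re g]. *)
Lemma circle_nearest_lt (x g : algC) :
    `|x| = 1 -> `|g| = 1 -> g != 1 ->
    'Re (x * g) <= 'Re x -> 'Re (x / g) <= 'Re x -> ~~ ('Re x <= 'Re g).
Proof.
move=> x1 g1 gN1; rewrite ReM Re_div g1 expr1n divr1.
have := normC2_Re_Im x; have := normC2_Re_Im g; rewrite x1 g1 expr1n.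
have Rg := Creal_Re g; have Rx := Creal_Re x.
have Ig := Creal_Im g; have Ix := Creal_Im x.
have c_lt1 : 'Re g < 1.
  rewrite lt_neqAle -[X in _ <= X]g1 (leif_Re_Creal g) andbT.
  apply: contra gN1 => /eqP Reg1; have := leif_Re_Creal g.
  rewrite g1 Reg1 => -[_]; rewrite eqxx => /esym g_ge0.
  by rewrite -g1 ger0_norm.
move: ('Re g) ('Re x) ('Im g) ('Im x) Rg Rx Ig Ix c_lt1 => c a s b Rc Ra Rs Rb c1.
move=> cs1 ab1 h1 h2; apply/negP => le_ac.
have t_gt0 : 0 < 1 - c by rewrite subr_gt0.
have h1' : 0 <= a * (1 - c) + b * s.
  by rewrite (_ : _ + _ = a - (a * c - b * s)) ?subr_ge0 //; ring.
have h2' : 0 <= a * (1 - c) - b * s.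
  by rewrite (_ : _ - _ = a - (a * c + b * s)) ?subr_ge0 //; ring.
have a_ge0 : 0 <= a.
  rewrite -(pmulr_lge0 _ t_gt0) -(pmulr_lge0 _ (ltr0n _ 2)).
  rewrite (_ : a * (1 - c) * 2 = (a * (1 - c) + b * s) + (a * (1 - c) - b * s)); last by ring.
  by rewrite addr_ge0.
have h3 : 0 <= 2 * a ^+ 2 - (1 + c).
  rewrite -(pmulr_lge0 _ t_gt0).
  have b2 : b ^+ 2 = 1 - a ^+ 2 by rewrite ab1 [_ + b ^+ 2]addrC addrK.
  have s2 : s ^+ 2 = 1 - c ^+ 2 by rewrite cs1 [_ + s ^+ 2]addrC addrK.
  rewrite (_ : _ * (1 - c) = (a * (1 - c) + b * s) * (a * (1 - c) - b * s)).
    exact: mulr_ge0.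
  transitivity (a ^+ 2 * (1 - c) ^+ 2 - b ^+ 2 * s ^+ 2); last by ring.
  by rewrite b2 s2; ring.
have h4 : a ^+ 2 <= c.
  have c_ge0 := le_trans a_ge0 le_ac.
  rewrite expr2 (le_trans (ler_wpM2l a_ge0 le_ac)) //.
  by rewrite -[X in _ <= X]mul1r ler_wpM2r // (le_trans le_ac) // ltW.
rewrite subr_ge0 in h3.
have : 2 * a ^+ 2 < 1 + c.
  apply: (@le_lt_trans _ _ (2 * c)); first by rewrite ler_pM2l ?ltr0n.
  by rewrite mulr2n mulrDl !mul1r ltrD2r.
by move=> h5; have := lt_le_trans h5 h3; rewrite ltxx.
Qed.

(* If [y] is the element of the coset [z <g>] nearest to [1], then [y] lies strictly
   nearer to [1] than [g], which the choice of [g] only allows for [y = 1]. *)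
Lemma max_Re_unity_root_prim (N : nat) (g : algC) :
    (0 < N)%N -> g ^+ N = 1 -> g != 1 ->
    (forall x, x ^+ N = 1 -> x != 1 -> 'Re x <= 'Re g) ->
  N.-primitive_root g.
Proof.
move=> N_gt0 gN gN1 gmax.
have [d prim_g d_dvd] := prim_order_exists N_gt0 gN.
have d_gt0 := prim_order_gt0 prim_g.
have [z prim_z] := C_prim_root_exists N_gt0.
(* [z] has exact order [N], so this forces [N] to divide the order [d] of [g]. *)
suff zd : z ^+ d = 1.
  suff -> : N = d by [].
  by apply/eqP; rewrite eqn_dvd d_dvd andbT (prim_order_dvd prim_z) zd.
pose F (i : 'I_d) := 'Re (z * g ^+ i).
have Freal : {in predT, forall i, F i \is Num.real} by move=> i _; apply: Creal_Re.
case: (@real_arg_maxP _ _ (Ordinal d_gt0) predT F isT Freal) => i _ imax.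
pose y := z * g ^+ i.
have ymax k : 'Re (y * g ^+ k) <= 'Re y.
  have := imax (Ordinal (ltn_pmod (i + k) d_gt0)) isT.
  by rewrite /F /= (prim_expr_mod prim_g) exprD mulrA.
have yN : y ^+ N = 1.
  by rewrite exprMn (prim_expr_order prim_z) exprAC gN expr1n mulr1.
have [y1|yN1] := eqVneq y 1.
  have : y ^+ d = 1 by rewrite y1 expr1n.
  by rewrite exprMn exprAC (prim_expr_order prim_g) expr1n mulr1.
have : ~~ ('Re y <= 'Re g).
  apply: circle_nearest_lt; rewrite ?(norm_unity_root N) //.
    exact: (ymax 1%N).
  have -> : g^-1 = g ^+ d.-1; last exact: ymax.
  have g0 : g != 0 by rewrite (prim_root_eq0 prim_g) -lt0n.
  by apply: (mulfI g0); rewrite mulfV // -exprS prednK // (prim_expr_order prim_g).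
by rewrite gmax.
Qed.

(** It suffices that [w] has order [2l]. Among the nontrivial [2l]-th roots of unity take [g] of
    largest real part; it is primitive, and comparing it with [w] shows that [w] attains the same
    maximum. *)
Lemma eps_prim (l : nat) : (0 < l)%N -> l.-primitive_root (eps l).
Proof.
move=> l_gt0; pose N := (l * 2)%N.
have N_gt0 : (0 < N)%N by rewrite muln_gt0 l_gt0.
set w := l.-root (-1 : algC).
have wl : w ^+ l = -1 by rewrite rootCK.
have wN : w ^+ N = 1 by rewrite exprM wl sqrrN expr1n.
have m1N1 : (-1 : algC) != 1 by rewrite eq_sym -addr_eq0 -mulr2n pnatr_eq0.
have wN1 : w != 1.
  by apply: contra m1N1 => /eqP w1; rewrite -wl w1 expr1n.
suff prim_w : N.-primitive_root w.
  by have := dvdn_prim_root prim_w (dvdn_mulr 2 (dvdnn l)); rewrite mulKn.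
have [z prim_z] := C_prim_root_exists N_gt0.
pose F (i : 'I_N) := 'Re (z ^+ i).
pose P := [pred i : 'I_N | z ^+ i != 1].
have N_gt1 : (1 < N)%N by rewrite /N; case: (l) l_gt0.
have P1 : P (Ordinal N_gt1) by rewrite /= -(prim_order_dvd prim_z) dvdn1 gtn_eqF.
have Freal : {in P, forall i, F i \is Num.real} by move=> i _; apply: Creal_Re.
case: (@real_arg_maxP _ _ (Ordinal N_gt1) P F P1 Freal) => i Pi imax.
pose g := z ^+ i.
have gN : g ^+ N = 1 by rewrite exprAC (prim_expr_order prim_z) expr1n.
have gmax x : x ^+ N = 1 -> x != 1 -> 'Re x <= 'Re g.
  move=> /(prim_rootP prim_z)[k ->] xN1; exact: imax.
have prim_g := max_Re_unity_root_prim _ _ N_gt0 gN Pi gmax.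
have gl : g ^+ l = -1.
  have /eqP := gN; rewrite exprM sqrf_eq1 -(prim_order_dvd prim_g).
  case/orP => [dvd|/eqP //]; have := dvdn_leq l_gt0 dvd.
  by rewrite /N muln2 -addnn -[X in (_ <= X)%N]addn0 leq_add2l leqNgt l_gt0.
(* [w] has the largest real part among the [l]-th roots of -1 in the closed upper half plane, and
   [g] or its conjugate is one of these. *)
have Re_gw : 'Re g <= 'Re w.
  have [Img|Img] := real_leP (real0 _) (Creal_Im g).
    exact: rootC_Re_max.
  rewrite -Re_conj; apply: rootC_Re_max => //.
    by rewrite -rmorphXn /= gl rmorphN rmorph1.
  by rewrite Im_conj oppr_ge0 ltW.
by apply: max_Re_unity_root_prim => // x xN xN1; apply: le_trans (gmax x xN xN1) _.
Qed.

(** * Integrality of [Psi] *)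

Section MPolyEval.
Variables (n : nat) (R S : comNzRingType) (f : {rmorphism R -> S}).

Lemma map_mpoly_meval (v : 'I_n -> S) (p : {mpoly R[n]}) :
  (map_mpoly f p).@[v] = mmap f v p.
Proof.
rewrite /map_mpoly /mmap raddf_sum /=; apply: eq_bigr => m _.
by rewrite mevalM mevalC mmap1_id mevalX.
Qed.

Lemma rmorph_meval (v : 'I_n -> R) (p : {mpoly R[n]}) :
  f p.@[v] = mmap f (f \o v) p.
Proof.
rewrite /meval /mmap rmorph_sum /=; apply: eq_bigr => m _.
rewrite rmorphM rmorph_prod; congr (_ * _).
by apply: eq_bigr => i _; rewrite rmorphXn.
Qed.

Lemma mmap_comp_mpoly k (v : 'I_k -> S) (T : n.-tuple {mpoly R[k]}) p :
  mmap f v (p \mPo T) = mmap f (fun i => mmap f v (tnth T i)) p.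
Proof.
rewrite comp_mpolyE rmorph_sum /= [RHS]/mmap; apply: eq_bigr => m _.
rewrite mmapZ rmorph_prod; congr (_ * _).
by apply: eq_bigr => i _; rewrite rmorphXn.
Qed.

Lemma map_mpoly_mesym k : map_mpoly f (mesym n R k) = mesym n S k.
Proof.
rewrite !mesymE (raddf_sum (map_mpoly f)) /=; apply: eq_bigr => h _.
exact: map_mpolyX.
Qed.

Lemma mmap_mesym k (v : 'I_n -> S) : mmap f v (mesym n R k) = (mesym n S k).@[v].
Proof. by rewrite -map_mpoly_meval map_mpoly_mesym. Qed.

Lemma eq_mmap (v w : 'I_n -> S) p : v =1 w -> mmap f v p = mmap f w p.
Proof. by move=> e; rewrite -!map_mpoly_meval; apply: meval_eq. Qed.

End MPolyEval.

Lemma mesym_roots (R : idomainType) (k : nat) (z : k.-tuple R) (i : 'I_k) :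
  (mesym k R i.+1).@[tnth z]
    = (-1) ^+ i.+1 * (\prod_(c <- z) ('X - c%:P))`_(k - i.+1).
Proof.
have := @mroots_coeff R k z (lift ord0 i).
by rewrite /= /bump /= add1n => ->; rewrite signrMK.
Qed.

(* The point is that [w] does not depend on [B], [f] and [z]. *)
Lemma symmetric_roots_value (A : idomainType) (k : nat) (Q : {mpoly A[k]})
    (P : {poly A}) : Q \is symmetric ->
  exists w : A, forall (B : idomainType) (f : {rmorphism A -> B}) (z : k.-tuple B),
    map_poly f P = \prod_(c <- z) ('X - c%:P) -> mmap f (tnth z) Q = f w.
Proof.
move=> /sym_fundamental[t [<- _]].
(* By Vieta these signed coefficients map to the elementary symmetric functions of [z]. *)
exists t.@[fun i : 'I_k => (-1) ^+ i.+1 * P`_(k - i.+1)] => B f z Pz.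
rewrite mmap_comp_mpoly rmorph_meval; apply: eq_mmap => i /=.
rewrite tnth_mktuple mmap_mesym mesym_roots -Pz coef_map.
by rewrite rmorphM rmorphXn rmorphN1.
Qed.

(** Both families factor ['X^l - 1] over the divisors of [l]; by induction the factors of the proper
    divisors agree and cancel. *)
Lemma map_Cyclotomic (F : fieldType) (l : nat) (z : F) :
  l.-primitive_root z -> map_poly intr ('Phi_l) = cyclotomic z l.
Proof.
elim/ltn_ind: l z => l IHl z prim_z.
have l_gt0 := prim_order_gt0 prim_z.
have [uD _ inD] := divisors_correct l_gt0.
have := prod_Cyclotomic l_gt0 => /(congr1 (map_poly (intr : int -> F))).
rewrite rmorphB rmorph1 rmorph_prod /= map_polyXn (prod_cyclotomic prim_z).
rewrite (big_rem l) ?inD //= [RHS](big_rem l) ?inD //= divnn l_gt0 expr1.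
have -> : \prod_(d <- rem l (divisors l)) map_poly intr ('Phi_d)
    = \prod_(d <- rem l (divisors l)) cyclotomic (z ^+ (l %/ d)) d :> {poly F}.
  apply: eq_big_seq => d; rewrite mem_rem_uniq // !inE inD => /andP[d_neq d_dvd].
  by apply: IHl; rewrite ?dvdn_prim_root // ltn_neqAle d_neq dvdn_leq.
apply: mulIf; apply: monic_neq0.
by apply: monic_prod => d _; apply: cyclotomic_monic.
Qed.

(** [Psi l] is the case [z = eps l]; a root of unity in characteristic [p] gives its reduction. *)
Definition PsiR (R : nzRingType) (l : nat) (z : R) : {mpoly R[l]} :=
  \prod_(i < l | coprime i l) \sum_(j < l) (z ^+ (i * j)%N) *: 'X_j.

Lemma Psi_integral (l : nat) :
  exists PZ : {mpoly int[l]}, forall (F : fieldType) (z : F),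
    l.-primitive_root z -> map_mpoly intr PZ = PsiR F l z.
Proof.
pose A := [pred i : 'I_l | coprime i l]; pose k := #|A|.
(* The [k] outer variables stand for the primitive [l]-th roots; the variables of [Psi] sit in the
   coefficient ring, so that symmetry concerns the roots only. *)
pose Q : {mpoly {mpoly int[l]}[k]} :=
  \prod_(i < k) \sum_(j < l) ('X_j : {mpoly int[l]}) *: 'X_i ^+ j.
have symQ : Q \is symmetric.
  apply/issymP => s; rewrite rmorph_prod /= [RHS](reindex_inj (@perm_inj _ s)) /=.
  apply: eq_bigr => i _; rewrite raddf_sum; apply: eq_bigr => j _ /=.
  by rewrite msymZ rmorphXn /= /msym mmapX mmap1U.
have [w wP] := symmetric_roots_value _ _ _ (map_poly (@mpolyC l int) ('Phi_l)) symQ.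
exists w => F z prim_z.
pose zs := [tuple (z ^+ (enum_val i : 'I_l))%:MP_[l] | i < k].
have := wP _ (map_mpoly (intr : int -> F)) zs.
rewrite -map_poly_comp (@eq_map_poly _ _ _ ((@mpolyC l F) \o intr)); last first.
  by move=> c /=; rewrite map_mpolyC.
rewrite map_poly_comp (map_Cyclotomic _ _ _ prim_z) => <-; last first.
  rewrite big_tuple /cyclotomic rmorph_prod /= (@big_enum_val _ _ _ _ A).
  apply: eq_bigr => i _; rewrite tnth_mktuple rmorphB /= map_polyX map_polyC.
  by [].
rewrite /Q rmorph_prod /= /PsiR [RHS](@big_enum_val _ _ _ _ A).
apply: eq_bigr => i _; rewrite raddf_sum; apply: eq_bigr => j _.
rewrite /= mmapZ rmorphXn /= mmapX mmap1U map_mpolyX tnth_mktuple.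
by rewrite -rmorphXn /= -exprM mulrC mul_mpolyC.
Qed.

(** * Products over orbits and partitions *)

Section MSymComp.
Variables (n : nat) (R : comNzRingType).

Lemma msym_comp_tuple (s : 'S_n) (p : {mpoly R[n]}) :
  msym s p = p \mPo [tuple 'X_(s i) | i < n].
Proof.
rewrite -[LHS]comp_mpoly_id msym_mPo; congr (_ \mPo _).
by apply: eq_from_tnth => i; rewrite !tnth_mktuple.
Qed.

Lemma msym_comp_mpoly k (s : 'S_k) (p : {mpoly R[n]}) (T : n.-tuple {mpoly R[k]}) :
  msym s (p \mPo T) = p \mPo [tuple msym s (tnth T i) | i < n].
Proof.
rewrite !comp_mpolyE (raddf_sum (msym s)) /=; apply: eq_bigr => m _.
rewrite msymZ; congr (_ *: _); rewrite (rmorph_prod (msym s)) /=.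
apply: eq_bigr => i _.
by rewrite (rmorphXn (msym s)) /= tnth_mktuple.
Qed.

(** This makes the order in which the blocks of a partition are listed irrelevant. *)
Lemma symmetric_comp_perm k (p : {mpoly R[n]}) (T U : n.-tuple {mpoly R[k]}) :
  p \is symmetric -> perm_eq T U -> p \mPo T = p \mPo U.
Proof.
move=> /issymP p_sym /tuple_permP[s TE].
rewrite -[in RHS](p_sym s) msym_mPo; congr (_ \mPo _).
exact: val_inj.
Qed.

Lemma mmap_msym (S : comNzRingType) (f : {rmorphism R -> S}) (v : 'I_n -> S)
    (s : 'S_n) p : mmap f v (msym s p) = mmap f (v \o s) p.
Proof.
rewrite msym_comp_tuple mmap_comp_mpoly; apply: eq_mmap => i.
by rewrite tnth_mktuple mmapX mmap1U.
Qed.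

End MSymComp.

Lemma map_mpoly_inj (n : nat) (R S : nzRingType) (f : {rmorphism R -> S}) :
  injective f -> injective (@map_mpoly n R S f).
Proof.
move=> f_inj p q /mpolyP pq; apply/mpolyP => m; apply: f_inj.
by have := pq m; rewrite !mcoeff_map_mpoly.
Qed.

Lemma map_mpoly_msym (n : nat) (R S : nzRingType) (f : {rmorphism R -> S}) (s : 'S_n) p :
  map_mpoly f (msym s p) = msym s (map_mpoly f p).
Proof. by apply/mpolyP => m; rewrite mcoeff_map_mpoly !mcoeff_sym mcoeff_map_mpoly. Qed.

(* [Theta n l] is [partition_prod n (orbit_prod (Psi l))]. *)
Definition orbit_prod (R : nzRingType) (l : nat) (P : {mpoly R[l]}) : {mpoly R[l]} :=
  \prod_(Q <- undup [seq msym s P | s : 'S_l]) Q.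

Definition partition_prod (R : nzRingType) (n l : nat) (Q : {mpoly R[l]}) : {mpoly R[n]} :=
  \prod_(P : {set {set 'I_n}} | part_nl n l P)
     (Q \mPo [tuple \sum_(a in nth set0 (enum P) j) 'X_a | j < l]).
Arguments partition_prod {R} n {l} Q.
Arguments orbit_prod {R l} P.

Lemma orbit_prod_sym (R : comNzRingType) (l : nat) (P : {mpoly R[l]}) :
  orbit_prod P \is symmetric.
Proof.
apply/issymP => s; rewrite /orbit_prod rmorph_prod /=.
rewrite -(big_map (msym s) xpredT id); apply: perm_big; apply: uniq_perm.
- by rewrite map_inj_uniq ?undup_uniq //; apply: inj_msym.
- exact: undup_uniq.
move=> Q; rewrite mem_undup; apply/mapP/imageP => [[Q1]|[t _ ->]].
  rewrite mem_undup => /imageP[t _ ->] ->.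
  by exists (t * s)%g; rewrite // msymMm.
exists (msym (t * s^-1)%g P); last by rewrite -msymMm mulgKV.
by rewrite mem_undup; apply/imageP; exists (t * s^-1)%g.
Qed.

(** An injective [f] keeps distinct orbit elements distinct, so [undup] removes the same repetitions
    on both sides. Reduction modulo [p] could merge some; the orbit is therefore formed over the
    integers and only then evaluated. *)
Lemma map_orbit_prod (R S : comNzRingType) (f : {rmorphism R -> S}) (l : nat)
    (P : {mpoly R[l]}) : injective f ->
  map_mpoly f (orbit_prod P) = orbit_prod (map_mpoly f P).
Proof.
move=> f_inj; rewrite /orbit_prod (rmorph_prod (map_mpoly f)) /=.
rewrite -(big_map (map_mpoly f) xpredT id).
rewrite -(undup_map_inj (map_mpoly_inj _ _ _ _ f_inj)) -map_comp.
by congr (bigop _ (undup _) _); apply: eq_map => s /=; apply: map_mpoly_msym.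
Qed.

Lemma block_tupleE (n l : nat) (U : Type) (F : {set 'I_n} -> U) (P : {set {set 'I_n}}) :
  #|P| = l -> [tuple F (nth set0 (enum P) j) | j < l] = [seq F B | B <- enum P] :> seq U.
Proof.
move=> Pl; have szP : size (enum P) = l by rewrite -cardE.
rewrite -[in RHS](mkseq_nth set0 (enum P)) szP -map_comp /= -val_enum_ord.
by rewrite -map_comp.
Qed.

Lemma part_nl_imset (n l : nat) (s : 'S_n) (P : {set {set 'I_n}}) :
  part_nl n l P -> part_nl n l [set s @: B | B : {set 'I_n} in P].
Proof.
have s_inj := imset_inj (@perm_inj _ s).
case/andP=> /andP[/and3P[/eqP covP trivP set0P] Pl] /forall_inP sizeP.
rewrite /part_nl card_imset // Pl andbT; apply/andP; split; last first.
  by apply/forall_inP => _ /imsetP[B BP ->]; rewrite card_imset ?sizeP //; apply: perm_inj.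
apply/and3P; split.
- rewrite /cover big_imset /=; last by move=> ? ? _ _; apply: s_inj.
  apply/eqP/setP => i; rewrite inE; apply/bigcupP.
  have : (s^-1)%g i \in cover P by rewrite covP inE.
  case/bigcupP => B BP iB; exists B => //; apply/imsetP.
  by exists ((s^-1)%g i); rewrite ?permKV.
- apply/trivIsetP => _ _ /imsetP[B BP ->] /imsetP[C CP ->] neq.
  have neqBC : B != C by apply: contra neq => /eqP->.
  move/trivIsetP/(_ _ _ BP CP neqBC): trivP.
  rewrite -!setI_eq0 -imsetI ?imset_eq0 //.
  by move=> ? ? _ _; apply: perm_inj.
- by apply: contra set0P => /imsetP[B BP /esym/eqP]; rewrite imset_eq0 => /eqP <-.
Qed.

(** A permutation of the variables permutes the partitions, hence the factors. *)
Lemma partition_prod_sym (R : comNzRingType) (n l : nat) (Q : {mpoly R[l]}) :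
  Q \is symmetric -> partition_prod n Q \is symmetric.
Proof.
move=> Qsym; apply/issymP => s; rewrite /partition_prod rmorph_prod /=.
pose act (t : 'S_n) (P : {set {set 'I_n}}) := [set t @: B | B : {set 'I_n} in P].
have actK t : cancel (act t) (act t^-1%g).
  move=> P; rewrite /act -imset_comp -[RHS]imset_id; apply: eq_imset => B /=.
  rewrite -imset_comp -[RHS]imset_id; apply: eq_imset => i /=; exact: permK.
have actKV t : cancel (act t^-1%g) (act t) by move=> P; rewrite -{1}[t]invgK actK.
have s_inj := imset_inj (@perm_inj _ s).
rewrite [RHS](reindex (act s)) /=; last first.
  by exists (act s^-1%g) => P _; [apply: actK | apply: actKV].
apply: eq_big => [P|P PP].
  apply/idP/idP => [|PP]; first exact: part_nl_imset.
  by rewrite -(actK s P); apply: part_nl_imset.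
(* The enumerations of [P] and of [act s P] need not correspond under [s]; the symmetry of [Q]
   absorbs the difference. *)
rewrite msym_comp_mpoly; apply: symmetric_comp_perm => //.
have /andP[/andP[_ /eqP Pl] _] := PP.
have aPl : #|act s P| = l by rewrite card_imset.
rewrite (block_tupleE _ _ _ (fun B => \sum_(a in B) 'X_a) _ aPl).
rewrite (eq_mktuple (fun j : 'I_l => msym s (\sum_(a in nth set0 (enum P) j) 'X_a)));
  last by move=> j; rewrite tnth_mktuple.
rewrite (block_tupleE _ _ _ (fun B => msym s (\sum_(a in B) 'X_a)) _ Pl).
have -> : [seq msym s (\sum_(a in B) 'X_a) | B : {set 'I_n} <- enum P]
  = [seq \sum_(a in B) ('X_a : {mpoly R[n]}) | B : {set 'I_n} <- [seq s @: B | B : {set 'I_n} <- enum P]].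
  rewrite -map_comp; apply: eq_map => B /=.
  rewrite big_imset /=; last by move=> ? ? _ _; apply: perm_inj.
  rewrite (raddf_sum (msym s)) /=; apply: eq_bigr => a _.
  by rewrite /msym mmapX mmap1U.
apply: perm_map; apply: uniq_perm; rewrite ?map_inj_uniq ?enum_uniq //.
by move=> B; rewrite mem_enum; apply/mapP/imsetP => -[C CP ->]; exists C; rewrite // mem_enum in CP *.
Qed.

Lemma map_partition_prod (R S : comNzRingType) (f : {rmorphism R -> S}) (n l : nat)
    (Q : {mpoly R[l]}) : injective f ->
  map_mpoly f (partition_prod n Q) = partition_prod n (map_mpoly f Q).
Proof.
move=> f_inj; rewrite /partition_prod (rmorph_prod (map_mpoly f)) /=.
apply: eq_bigr => P _; rewrite map_mpoly_comp //; congr (_ \mPo _).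
apply: eq_from_tnth => i; rewrite tnth_map !tnth_mktuple.
by rewrite (raddf_sum (map_mpoly f)) /=; apply: eq_bigr => a _; rewrite map_mpolyX.
Qed.

(** * The partition of the indices into residue classes modulo [l] *)

Definition residue_block (n l : nat) (j : 'I_l) : {set 'I_n} :=
  [set i : 'I_n | (i %% l)%N == j].
Arguments residue_block n {l} j.

Lemma card_residue_block (n l : nat) (j : 'I_l) :
  (l %| n)%N -> #|residue_block n j| = (n %/ l)%N.
Proof.
move=> l_dvd; have l_gt0 : (0 < l)%N by apply: leq_ltn_trans (ltn_ord j).
have bnd (k : 'I_(n %/ l)) : (k * l + j < n)%N.
  rewrite -[X in (_ < X)%N](divnK l_dvd) (@leq_trans (k.+1 * l)) //.
    by rewrite mulSn addnC ltn_add2r.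
  by rewrite leq_mul2r ltn_ord orbT.
pose h k := Ordinal (bnd k).
have -> : residue_block n j = h @: 'I_(n %/ l).
  apply/setP => i; rewrite inE; apply/eqP/imsetP => [ij|[k _ ->]]; last first.
    by rewrite /= modnMDl modn_small.
  have kP : (i %/ l < n %/ l)%N by rewrite ltn_divLR // divnK.
  by exists (Ordinal kP) => //; apply: val_inj; rewrite /= -ij -divn_eq.
rewrite card_imset ?card_ord // => k1 k2 /(congr1 val) /= /addIn /eqP.
by rewrite eqn_pmul2r // => /eqP/val_inj.
Qed.

Section ResiduePartition.
Variables (n l : nat).
Hypotheses (n_gt0 : (0 < n)%N) (l_dvd : (l %| n)%N).

Let l_gt0 : (0 < l)%N := dvdn_gt0 n_gt0 l_dvd.

Lemma residue_block_inj : injective (@residue_block n l).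
Proof.
move=> j k jk; have : (0 < #|residue_block n j|)%N.
  by rewrite card_residue_block // divn_gt0 // dvdn_leq.
case/card_gt0P => i ij; have := ij; rewrite jk; move: ij.
by rewrite !inE => /eqP ij /eqP ik; apply: val_inj; rewrite /= -ij.
Qed.

Lemma part_nl_residue : part_nl n l [set residue_block n j | j : 'I_l].
Proof.
rewrite /part_nl card_imset ?card_ord ?eqxx ?andbT; last exact: residue_block_inj.
apply/andP; split; last first.
  by apply/forall_inP => _ /imsetP[j _ ->]; rewrite card_residue_block.
apply/and3P; split.
- rewrite /cover big_imset /=; last by move=> ? ? _ _; apply: residue_block_inj.
  apply/eqP/setP => i; rewrite inE; apply/bigcupP.
  by exists (Ordinal (ltn_pmod i l_gt0)); rewrite ?inE.
- apply/trivIsetP => _ _ /imsetP[j _ ->] /imsetP[k _ ->] neq.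
  rewrite -setI_eq0; apply: contraR neq => /set0Pn[i]; rewrite !inE.
  by case/andP=> /eqP ij /eqP ik; apply/eqP; congr residue_block; apply: val_inj; rewrite /= -ij.
- apply/imsetP => -[j _ /esym/eqP]; rewrite -cards_eq0 card_residue_block //.
  by rewrite -leqn0 leqNgt divn_gt0 // dvdn_leq.
Qed.

(** A single linear factor vanishes: for the partition into residue classes, the factor of [PsiR]
    with exponent 1 is the given sum grouped by residues. *)
Lemma partition_prod_vanish (F : fieldType) (z : F) (v : 'I_n -> F)
    (PZ : {mpoly int[l]}) :
    l.-primitive_root z -> map_mpoly intr PZ = PsiR F l z ->
    \sum_(i < n) z ^+ i * v i = 0 ->
  mmap intr v (partition_prod n (orbit_prod PZ)) = 0.
Proof.
move=> prim_z PZz zv0.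
rewrite /partition_prod (rmorph_prod (mmap intr v)) /=; apply/eqP.
apply/prodf_eq0; exists [set residue_block n j | j : 'I_l].
  exact: part_nl_residue.
set P := [set _ | _ in _].
have Pl : #|P| = l by rewrite card_imset ?card_ord //; apply: residue_block_inj.
pose y (j : 'I_l) := \sum_(a in residue_block n j) v a.
(* [enum P] lists the residue classes in an unspecified order, recorded by [s]; the orbit element
   [msym s^-1 PZ] will undo it. *)
have [s sP] : exists s : 'S_l, forall j : 'I_l, nth set0 (enum P) j = residue_block n (s j).
  pose T := [tuple residue_block n j | j < l].
  have /tuple_permP[s sE] : perm_eq (enum P) T.
    apply: uniq_perm; rewrite ?enum_uniq //=.
      by rewrite map_inj_uniq ?enum_uniq //; apply: residue_block_inj.
    move=> B; rewrite mem_enum; apply/imsetP/mapP => -[j _ ->]; exists j => //.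
    by rewrite mem_enum.
  exists s => j.
  by rewrite sE -tnth_nth !tnth_mktuple.
rewrite mmap_comp_mpoly (eq_mmap _ _ _ _ _ (y \o s)); last first.
  move=> j; rewrite tnth_mktuple sP (raddf_sum (mmap intr v)) /=.
  by apply: eq_bigr => a _; rewrite mmapX mmap1U.
rewrite /orbit_prod (rmorph_prod (mmap intr _)) /= prodf_seq_eq0.
apply/hasP; exists (msym s^-1%g PZ).
  by rewrite mem_undup; apply/imageP; exists s^-1%g.
rewrite /= mmap_msym (eq_mmap _ _ _ _ _ y); last by move=> j /=; rewrite permKV.
rewrite -map_mpoly_meval PZz /PsiR (rmorph_prod (meval y)) /=.
(* The index is 1 modulo [l], which is 0 when [l = 1]; it is coprime to [l] in either case. *)
apply/prodf_eq0; exists (Ordinal (ltn_pmod 1 l_gt0)).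
  by rewrite /= coprime_modl coprime1n.
rewrite (raddf_sum (meval y)) /= -[X in _ == X]zv0.
rewrite [X in _ == X](partition_big (fun i : 'I_n => Ordinal (ltn_pmod i l_gt0)) xpredT) //.
apply/eqP; apply: eq_bigr => j _; rewrite mevalZ mevalXU.
rewrite exprM (prim_expr_mod prim_z) expr1 /y mulr_sumr.
apply: eq_big => [i|i]; rewrite inE -?val_eqE //= => /eqP <-.
by rewrite (prim_expr_mod prim_z).
Qed.

End ResiduePartition.

(** * Vanishing of [theta] and [h_pn] *)

Lemma map_mpoly_intr (n : nat) (R S : comNzRingType) (f : {rmorphism R -> S})
    (t : {mpoly int[n]}) : map_mpoly f (map_mpoly intr t) = map_mpoly intr t.
Proof. by apply/mpolyP => m; rewrite !mcoeff_map_mpoly /= rmorph_int. Qed.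

(** [Theta n l] comes from an integral symmetric polynomial [ThetaZ], so the fundamental theorem
    over the integers supplies a polynomial meeting [theta_spec]. Injectivity of the integers into
    [algC] turns the specification into an integral identity, which can be evaluated in any
    field. *)
Lemma theta_vanish (n l : nat) (F : fieldType) (z : F) (v : 'I_n -> F) :
    (0 < n)%N -> (l %| n)%N -> l.-primitive_root z ->
    \sum_(i < n) z ^+ i * v i = 0 ->
  (map_mpoly intr (theta n l)).@[fun i => (mesym n F i.+1).@[v]] = 0.
Proof.
move=> n_gt0 l_dvd prim_z zv0.
have [PZ PZP] := Psi_integral l.
pose ThetaZ := partition_prod n (orbit_prod PZ).
have ThetaE : map_mpoly intr ThetaZ = Theta n l.
  rewrite map_partition_prod; last exact: intr_inj.
  rewrite map_orbit_prod; last exact: intr_inj.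
  by rewrite (PZP _ _ (eps_prim _ (dvdn_gt0 n_gt0 l_dvd))).
have mapS (t : {mpoly int[n]}) :
    map_mpoly intr (t \mPo [tuple mesym n int i.+1 | i < n])
    = map_mpoly intr t \mPo [tuple mesym n algC i.+1 | i < n].
  rewrite map_mpoly_comp; last exact: intr_inj.
  congr (_ \mPo _); apply: eq_from_tnth => i.
  by rewrite tnth_map !tnth_mktuple map_mpoly_mesym.
have /sym_fundamental[t [tE _]] : ThetaZ \is symmetric.
  by apply: partition_prod_sym; apply: orbit_prod_sym.
have spec : theta_spec n l (theta n l).
  apply: epsilon_spec; exists t.
  by rewrite /theta_spec -ThetaE -tE mapS.
have thetaE : theta n l \mPo [tuple mesym n int i.+1 | i < n] = ThetaZ.
  apply: (map_mpoly_inj _ _ algC intr); first exact: intr_inj.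
  by rewrite mapS ThetaE -spec.
have := partition_prod_vanish _ _ n_gt0 l_dvd _ _ _ _ prim_z (PZP _ _ prim_z) zv0.
rewrite -/ThetaZ -thetaE mmap_comp_mpoly map_mpoly_meval => <-.
by apply: eq_mmap => i; rewrite tnth_mktuple mmap_mesym.
Qed.

Lemma mesym_opp (n k : nat) (R : comNzRingType) (v : 'I_n -> R) :
  (mesym n R k).@[fun i => - v i] = (-1) ^+ k * (mesym n R k).@[v].
Proof.
rewrite /mesym !raddf_sum /= mulr_sumr; apply: eq_bigr => h /eqP <-.
rewrite !rmorph_prod /= -prodrN; apply: eq_bigr => i _.
by rewrite !mevalXU.
Qed.

Section FpEmbedding.
Variables (p : nat) (F : fieldType).
Hypotheses (p_pr : prime p) (pcharF : p \in [pchar F]).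

(** The coefficient map of the theorem is a bare function on representatives; it is shown here to be
    a ring morphism in characteristic [p]. *)
Definition Fp_embed (x : 'F_p) : F := (x : nat)%:R.

Lemma Fp_embedD : {morph Fp_embed : x y / x + y}.
Proof.
by move=> x y; rewrite /Fp_embed /= [X in (_ %% X)%N]Fp_cast // (GRing.natr_mod_pchar pcharF) natrD.
Qed.

Lemma Fp_embedB : zmod_morphism Fp_embed.
Proof. by move=> x y; rewrite -[in RHS](subrK y x) [in RHS]Fp_embedD addrK. Qed.

Lemma Fp_embedM : monoid_morphism Fp_embed.
Proof.
split; first by rewrite /Fp_embed /= modn_small // Fp_cast ?prime_gt1.
by move=> x y; rewrite /Fp_embed /= [X in (_ %% X)%N]Fp_cast // (GRing.natr_mod_pchar pcharF) natrM.
Qed.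

End FpEmbedding.

Lemma h_pn_vanish (p n l : nat) (F : fieldType) (a : 'I_n -> F) :
    prime p -> p \in [pchar F] -> (l %| n %/ p ^ logn p n)%N -> (0 < n)%N ->
    (map_mpoly intr (theta n l)).@[a] = 0 ->
  (map_mpoly (fun x : 'F_p => (x : nat)%:R : F) (h_pn p n)).@[a] = 0.
Proof.
move=> p_pr pcharF l_dvd n_gt0 th0.
pose eA := GRing.isZmodMorphism.Build _ _ (Fp_embed p F) (Fp_embedB _ _ p_pr pcharF).
pose eM := GRing.isMonoidMorphism.Build _ _ (Fp_embed p F) (Fp_embedM _ _ p_pr pcharF).
pose e : {rmorphism 'F_p -> F} := HB.pack (Fp_embed p F) eA eM.
change ((map_mpoly e (h_pn p n)).@[a] = 0).
rewrite /h_pn (rmorph_prod (map_mpoly e)) (rmorph_prod (meval a)) /=; apply/eqP.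
set m := (n %/ _)%N in l_dvd *.
have m_gt0 : (0 < m)%N.
  by rewrite divn_gt0 ?expn_gt0 ?prime_gt0 // dvdn_leq // pfactor_dvdnn.
have l_lt : (l < m.+1)%N by rewrite ltnS dvdn_leq.
apply/prodf_eq0; exists (Ordinal l_lt) => //=.
by rewrite (map_mpoly_intr _ _ _ e) th0.
Qed.

(** * Frobenius orbits *)

Section Frobenius.
Variables (F : finFieldType) (L : fieldExtType F).

Definition frob (x : L) : L := x ^+ #|F|.

Lemma frob_zmod : zmod_morphism frob.
Proof.
rewrite /frob => x y.
have [p _ pcharFp] := finPcharP F; rewrite (card_pprimeChar pcharFp).
(* The power map is an iterate of the additive [p]-th power map. *)
elim: (logn _ _) => // k IHk; rewrite expnSr !exprM {}IHk.
by rewrite -(pchar_lalg L) in pcharFp; rewrite -pFrobenius_autE rmorphB.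
Qed.

Lemma frob_monoid : monoid_morphism frob.
Proof. by rewrite /frob; split=> [|x y]; rewrite ?expr1n ?exprMn. Qed.

HB.instance Definition _ := GRing.isZmodMorphism.Build L L frob frob_zmod.
HB.instance Definition _ := GRing.isMonoidMorphism.Build L L frob frob_monoid.

Lemma frob_alg (c : F) : frob (c%:A) = c%:A.
Proof. by rewrite /frob -in_algE -rmorphXn /= expf_card. Qed.

Lemma frobZ (c : F) (x : L) : frob (c *: x) = c *: frob x.
Proof. by rewrite -mulr_algl rmorphM /= frob_alg mulr_algl. Qed.

(** [x] is a root of ['X^#|F| - 'X], which already splits over [F] with the elements of [F] as
    roots. *)
Lemma frob_fixed (x : L) : frob x = x -> x \in 1%VS.
Proof.
move=> xFx; apply/vlineP.
have : root (map_poly (in_alg L) ('X^#|F| - 'X)) x.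
  rewrite rmorphB /= map_polyXn map_polyX rootE !(hornerE, hornerXn).
  by rewrite [x ^+ _]xFx subrr.
have -> : map_poly (in_alg L) ('X^#|F| - 'X) = \prod_(z <- [seq b%:A | b : F]) ('X - z%:P).
  rewrite finField_genPoly rmorph_prod big_image /=.
  by apply: eq_bigr => b _; rewrite rmorphB /= map_polyX map_polyC.
by rewrite root_prod_XsubC => /mapP[c _ ->]; exists c.
Qed.

(** The product [g] over the Frobenius orbit of one root has coefficients in [F] and divides [f]; by
    irreducibility it equals [f], so the roots form a single orbit. *)
Lemma irreducible_roots_frob (f : {poly F}) (r : seq L) :
    irreducible_poly f -> map_poly (in_alg L) f = \prod_(x <- r) ('X - x%:P) ->
  exists2 x : L, perm_eq r (traject frob x (size r)) & iter (size r) frob x = x.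
Proof.
move=> [f_gt1 f_irr] fr.
have : (0 < size r)%N.
  by rewrite -ltnS -(size_prod_XsubC r id) -fr size_map_poly.
case Dr: r => [//|x r0] _; rewrite -Dr.
have root_x : root (map_poly (in_alg L) f) x by rewrite fr root_prod_XsubC Dr mem_head.
have root_frob y : root (map_poly (in_alg L) f) y -> root (map_poly (in_alg L) f) (frob y).
  move=> /rootP fy0; apply/rootP; rewrite -[RHS](rmorph0 frob) -[in RHS]fy0.
  rewrite -horner_map -map_poly_comp; congr (_.[_]).
  by apply: eq_map_poly => c /=; rewrite frob_alg.
(* Orbits of functions are available on finite types, hence the passage to [finvect_type L]. *)
pose frobf : finvect_type L -> finvect_type L := frob.
have frob_inj : injective frobf by apply: (fmorph_inj frob).
pose d := fingraph.order frobf x.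
have dx : iter d frob x = x by apply: (iter_order frob_inj).
have o_uniq : uniq (traject frob x d) by apply: (orbit_uniq frobf x).
have d_gt0 : (0 < d)%N by apply: fingraph.order_gt0.
pose g := \prod_(y <- traject frob x d) ('X - y%:P).
have /polyOver1P[g0 Dg0] : g \is a polyOver 1%VS.
  apply/polyOverP => i; apply: frob_fixed.
  (* Frobenius rotates the orbit, so it only permutes the factors of [g]. *)
  suff {2}<- : map_poly frob g = g by rewrite coef_map.
  rewrite /g rmorph_prod /=; under eq_bigr do rewrite rmorphB /= map_polyX map_polyC /=.
  rewrite -(big_map frob xpredT (fun y => 'X - y%:P)); apply: perm_big.
  have map_traject k y : [seq frob i | i <- traject frob y k] = traject frob (frob y) k.
    by elim: k y => //= k IHk y; rewrite IHk.
  by rewrite map_traject -(perm_cons x) -trajectS trajectSr dx perm_rcons.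
have g_dvd : g %| map_poly (in_alg L) f.
  apply: uniq_roots_dvdp; last by rewrite uniq_rootsE.
  apply/allP => y /trajectP[i _ ->]; elim: i => //= i; exact: root_frob.
have g_eqp : g %= map_poly (in_alg L) f.
  rewrite Dg0 eqp_map; apply: f_irr; last by rewrite -(dvdp_map (in_alg L)) -Dg0.
  rewrite -(size_map_poly (in_alg L)) -Dg0 size_prod_XsubC size_traject.
  by rewrite eqSS -lt0n.
have rE : perm_eq r (traject frob x d).
  apply: prod_XsubC_eq; rewrite -fr; apply/esym/eqP.
  by rewrite -eqp_monic // ?monic_prod_XsubC // fr monic_prod_XsubC.
by exists x; rewrite (perm_size rE) size_traject.
Qed.

(** * Circulant polynomials and linear relations between conjugates *)

Section Circulant.
Variables (n : nat) (x : L).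
Hypotheses (n_gt0 : (0 < n)%N) (xn : iter n frob x = x).

Let A t : {poly L} := \sum_(j < n) iter (j + t) frob x *: 'X^j.

(** Modulo ['X^n - 1], multiplication by ['X] rotates coefficients, and those of [A t.+1] are those
    of [A t] rotated. *)
Lemma circulant_shift t : 'X * A t.+1 = A t + iter t frob x *: ('X^n - 1).
Proof.
rewrite /A; case: (n) n_gt0 xn => // k _ kx.
rewrite big_ord_recr [X in _ = X + _]big_ord_recl /= mulrDr mulr_sumr.
rewrite add0n expr0 scalerBr [X in _ = X + _]addrC [X in _ = _ + X]addrC.
rewrite addrA addrK; congr (_ + _).
  apply: eq_bigr => j _.
  by rewrite -scalerAr -exprS /bump /= add1n addnS.
by rewrite -scalerAr -exprS addnS -addSn addnC iterD kx.
Qed.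

(** Frobenius carries the relation to every shift, so [k] also annihilates the family [A i]. As
    ['X^i * A i] is congruent to [A 0], ['X^n - 1] divides [c * A 0], hence [c] by coprimality; the
    degree of [c] is too small unless [c = 0]. *)
Lemma free_frob_orbit (k : 'I_n -> F) :
    coprimep ('X^n - 1) (\sum_(j < n) iter j frob x *: 'X^j) ->
    \sum_(i < n) k i *: iter i frob x = 0 ->
  forall i, k i = 0.
Proof.
have -> : \sum_(j < n) iter j frob x *: 'X^j = A 0.
  by apply: eq_bigr => j _; rewrite addn0.
move=> cop kx0.
have kx t : \sum_(i < n) k i *: iter (t + i) frob x = 0.
  elim: t => // t IHt; rewrite -[RHS](rmorph0 frob) -[in RHS]IHt raddf_sum.
  by apply: eq_bigr => i _; rewrite /= frobZ.
have shift t : 'X^n - 1 %| 'X^t * A t - A 0.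
  elim: t => [|t IHt]; first by rewrite mul1r subrr dvdp0.
  rewrite exprSr -mulrA circulant_shift mulrDr addrAC dvdp_add //.
  by rewrite -mul_polyC mulrA dvdp_mull.
(* The exponents are reversed so that [rev_ord i + i] is always [n.-1] and ['X^(n.-1)] factors out
   below. *)
pose c : {poly L} := \sum_(i < n) (k i)%:A *: 'X^(rev_ord i).
have c_coef i : c`_(rev_ord i) = (k i)%:A.
  rewrite coef_sum (bigD1 i) //= coefZ coefXn eqxx mulr1 big1 ?addr0 // => j ji.
  rewrite coefZ coefXn (_ : _ == _ = false) ?mulr0 //.
  by rewrite -[LHS]/(rev_ord i == rev_ord j) (inj_eq rev_ord_inj) eq_sym; apply/negbTE.
suff c0 : c = 0.
  move=> i; apply: (fmorph_inj (in_alg L)); rewrite rmorph0 /= -c_coef c0.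
  by rewrite coef0.
apply/eqP; apply: contraT => c_neq0.
have sz_c : (size c <= n)%N.
  apply: leq_trans (size_sum _ _ _) _; apply/bigmax_leqP => i _.
  by apply: leq_trans (size_scale_leq _ _) _; rewrite size_polyXn ltn_ord.
suff : 'X^n - 1 %| c.
  by move/(dvdp_leq c_neq0); rewrite size_XnsubC // ltnNge sz_c.
rewrite -(Gauss_dvdpl _ cop).
have -> : c * A 0 = - (\sum_(i < n) (k i)%:A *: ('X^(rev_ord i) * ('X^i * A i - A 0))).
  have z0 : \sum_(i < n) (k i)%:A *: A i = 0.
    under eq_bigr do rewrite scaler_sumr.
    rewrite exchange_big big1 //= => j _.
    under eq_bigr do rewrite scalerA mulr_algl.
    by rewrite -scaler_suml kx scale0r.
  under eq_bigr do rewrite mulrBr scalerBr mulrA -exprD.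
  rewrite sumrB opprB mulr_suml.
  have -> : \sum_(i < n) (k i)%:A *: ('X^(rev_ord i + i) * A i)
      = 'X^(n.-1) * \sum_(i < n) (k i)%:A *: A i.
    rewrite mulr_sumr; apply: eq_bigr => i _; rewrite -scalerAr.
    congr (_ *: ('X^_ * _)).
    rewrite /=; move: (nat_of_ord i) (ltn_ord i) => j; case: (n) => // m jm.
    by rewrite subSS subnK.
  rewrite z0 mulr0 subr0; apply: eq_bigr => i _; by rewrite scalerAl.
rewrite dvdpNr; apply: (big_ind (fun q => 'X^n - 1 %| q)); first exact: dvdp0.
  by move=> p q; apply: dvdp_add.
by move=> i _; rewrite -mul_polyC !dvdp_mull.
Qed.

End Circulant.
End Frobenius.
Arguments frob {F L} x.

(** * From dependent roots to the vanishing of [h_pn] at the coefficients *)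

Lemma coef_monic_poly_rev (F : fieldType) (n : nat) (a : 'I_n -> F) (i : 'I_n) :
  ('X^n + \sum_(j < n) a j *: 'X^(n - j.+1))`_(n - i.+1) = a i.
Proof.
have rev_eq (j : 'I_n) : ((n - i.+1)%N == (n - j.+1)%N) = (j == i).
  by rewrite -[LHS]/(rev_ord i == rev_ord j) (inj_eq rev_ord_inj) eq_sym.
rewrite coefD coefXn ltn_eqF; last first.
  by rewrite ltn_subrL /= (leq_ltn_trans _ (ltn_ord i)).
rewrite add0r coef_sum (bigD1 i) //= coefZ coefXn eqxx mulr1 big1 ?addr0 // => j ji.
by rewrite coefZ coefXn rev_eq (negbTE ji) mulr0.
Qed.

Theorem theorem4p1 (p : nat) (F : finFieldType) (n : nat) (a : 'I_n -> F) :
  prime p -> p \in [pchar F] -> (0 < n)%N ->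
  irreducible_poly ('X^n + \sum_(i < n) a i *: 'X^(n - i.+1)) ->
  (map_mpoly (fun x : 'F_p => (x : nat)%:R : F) (h_pn p n)).@[a] != 0 ->
  forall (L : fieldExtType F) (r : n.-tuple L),
    map_poly (in_alg L) ('X^n + \sum_(i < n) a i *: 'X^(n - i.+1))
      = \prod_(x <- r) ('X - x%:P) ->
    free r.
Proof.
move=> p_pr pcharF n_gt0 f_irr h_neq0 L r fr.
have [x] := irreducible_roots_frob _ _ _ _ f_irr fr.
rewrite size_tuple => rx xn.
have -> : free r = free [tuple iter i frob x | i < n].
  rewrite (perm_free rx); congr (free _).
  apply: (@eq_from_nth _ x) => [|i]; rewrite size_traject ?size_tuple // => i_lt.
  by rewrite nth_traject // -[i]/(val (Ordinal i_lt)) -tnth_nth tnth_mktuple.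
apply/freeP => k kx0; apply: (free_frob_orbit _ _ n x n_gt0 xn); last first.
  rewrite -[RHS]kx0; apply: eq_bigr => i _.
  by rewrite -tnth_nth tnth_mktuple.
set A := \sum_(j < n) _; apply: contraNT h_neq0 => ncop.
have [K [iota0 _]] := countable_algebraic_closure (finvect_type L).
pose iota : {rmorphism L -> K} := iota0.
have [z] : exists z, root (map_poly iota (gcdp ('X^n - 1) A)) z.
  (* Failure of coprimality says exactly that the gcd does not have size 1. *)
  by apply/closed_rootP; rewrite size_map_poly.
rewrite gcdp_map root_gcd => /andP[/rootP zn /rootP zA].
have {}zn : z ^+ n = 1.
  by apply/eqP; rewrite -subr_eq0 -zn rmorphB rmorph1 /= map_polyXn !hornerE.
pose v (i : 'I_n) := - iota (iter i frob x).
have zv0 : \sum_(i < n) z ^+ i * v i = 0.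
  apply/eqP; rewrite -oppr_eq0 -sumrN -[X in _ == X]zA /A rmorph_sum horner_sum.
  apply/eqP; apply: eq_bigr => i _ /=.
  by rewrite map_polyZ map_polyXn !hornerE mulrN opprK mulrC.
have [l prim_z l_dvd] := prim_order_exists n_gt0 zn.
pose j : {rmorphism F -> K} := iota \o in_alg L.
have ja (i : 'I_n) : (mesym n K i.+1).@[v] = j (a i).
  rewrite mesym_opp.
  have -> : (mesym n K i.+1).@[fun i => iota (iter i frob x)]
     = (mesym n K i.+1).@[tnth [tuple iota (iter i frob x) | i < n]].
    by apply: meval_eq => i'; rewrite tnth_mktuple.
  rewrite mesym_roots signrMK.
  have -> : \prod_(c <- [tuple iota (iter i frob x) | i < n]) ('X - c%:P)
      = map_poly j ('X^n + \sum_(i < n) a i *: 'X^(n - i.+1)).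
    rewrite map_poly_comp fr (perm_big _ rx) rmorph_prod /= [LHS]big_map big_enum /=.
    rewrite [RHS](big_nth x) size_traject big_mkord; apply: eq_bigr => i' _.
    by rewrite nth_traject // rmorphB /= map_polyX map_polyC.
  by rewrite coef_map coef_monic_poly_rev.
(* In characteristic [p] no primitive root of unity has order divisible by [p]; thus [l], a divisor
   of [n], divides its part prime to [p]. *)
have cop_pl : coprime l (p ^ logn p n).
  rewrite coprime_sym coprimeXl // prime_coprime //; apply/negP => p_dvd.
  have := prim_root_pcharF prim_z p_dvd.
  by rewrite (fmorph_pchar j) pcharF.
apply/eqP; apply: (h_pn_vanish p n l) => //.
  by rewrite -(Gauss_dvdr _ cop_pl) mulnC divnK // pfactor_dvdnn.
(* The vanishing, known in [K] where [z] lives, descends to [F] because [j] is injective. *)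
apply: (fmorph_inj j); rewrite rmorph0 rmorph_meval -map_mpoly_meval map_mpoly_intr.
rewrite -[RHS](theta_vanish n l _ z v n_gt0 l_dvd prim_z zv0).
by apply: meval_eq => i; rewrite ja.
Qed.
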